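(* For every $c>0$ there exist constants $C_1,C_2>0$ and a positive integer $\hat q$, depending only on $c$, with the following property. Let $T$ be a minimal interval exchange transformation, and for each $n$ let $e_T(n)$ denote the minimum measure of any $n$-block interval of $T$. Let $(n_j)_{j\ge1}$ be a sequence of positive integers such that (1) $\frac{n_{j+1}}{n_j}>2$ for all $j$, and (2) $e_T(n_j)>\frac{c}{n_j}$ for all $j$. Let $J$ be any $n_i$-block interval of $T$ (for any $i$). Then for all points $x,x'\in[0,1)$ and all $L\in\mathbb{N}$, $$\frac1{n_{i+\hat q+L}}\Big|\sum_{j=1}^{n_{i+\hat q+L}}\big(\chi_J(T^jx)-\chi_J(T^jx')\big)\Big|<C_1e^{-C_2L}|J|.$$
   Context: Interval exchange transformation (IET): given $(l_1,\dots,l_d)$ with $l_i\ge0$, $\sum l_i=1$, put $I_1=[0,l_1)$, $I_2=[l_1,l_1+l_2)$, ..., $I_d=[l_1+\dots+l_{d-1},1)$; given a permutation $\pi$ of $\{1,\dots,d\}$, the IET $T:[0,1)\to[0,1)$ is $T(x)=x-\sum_{k<j}l_k+\sum_{\pi(k')<\pi(j)}l_{k'}$ for $x\in I_j$. The discontinuities of $T$ are the points of $D=\{\sum_{i=1}^r l_i\}_{r=1}^{d-1}$, and the discontinuities of $T^n$ are the points of $\bigcup_{i=0}^{n-1}T^{-i}D$. An $n$-block interval of $T$ is an interval bounded by two adjacent discontinuities of $T^n$, counting $0$ and $1$ as discontinuities. Measure is Lebesgue measure; $|J|$ is the length of $J$; $\chi_J$ is the indicator function of $J$. $T$ is minimal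 if every orbit is dense. *)

(* Defs.v *)
From HB Require Import structures.
From mathcomp Require Import all_boot all_order all_algebra all_fingroup.
From mathcomp Require Import all_classical all_reals all_analysis.

Set Implicit Arguments.
Unset Strict Implicit.
Unset Printing Implicit Defensive.

Import Order.TTheory GRing.Theory Num.Theory.
Import numFieldNormedType.Exports.

Local Open Scope classical_set_scope.
Local Open Scope ring_scope.

(* The d exchanged intervals are indexed by 'I_d, that is from 0 to d - 1. *)
Section IntervalExchange.
Variables (R : realType) (d : nat) (l : 'I_d -> R) (pi : 'S_d).

Definition iet_left (j : 'I_d) : R := \sum_(k < d | (k < j)%N) l k.

(* The right endpoint of the last interval is the sum of all the lengths,
   which is 1 for an interval exchange of [0, 1). *)
Definition iet_itv (j : 'I_d) : interval R :=
  `[iet_left j, iet_left j + l j[.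

(* Total extension of T : [0, 1) -> [0, 1), equal to the identity outside
   [0, 1).  The intervals iet_itv j are pairwise disjoint, so at most one j
   can be picked. *)
Definition iet (x : R) : R :=
  if [pick j | x \in iet_itv j] is Some j then
    x - iet_left j + \sum_(k < d | (pi k < pi j)%N) l k
  else x.

(* The points l_1 + ... + l_r for 1 <= r <= d - 1. *)
Definition iet_disc : set R :=
  [set iet_left r | r in [set r : 'I_d | (0 < r)%N]].

(* Discontinuities of T^n, with 0 and 1 counted as discontinuities. *)
Definition iet_iter_disc (n : nat) : set R :=
  [set 0; 1] `|`
  \bigcup_(i in `I_n) (`[0, 1[ `&` iter i iet @^-1` iet_disc).

(* As for the exchanged intervals themselves, block intervals are closed on
   the left and open on the right, so that they partition [0, 1). *)
Definition block_interval (n : nat) (J : set R) : Prop :=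
  exists a b : R,
    [/\ iet_iter_disc n a, iet_iter_disc n b, a < b,
        (forall y, a < y < b -> ~ iet_iter_disc n y) &
        J = `[a, b[%classic].

(* T is a bijection of [0, 1): orbits are taken over all integer iterates. *)
Definition iet_orbit (x : R) : set R :=
  `[0, 1[ `&` [set y | exists k, iter k iet x = y \/ iter k iet y = x].

Definition iet_minimal : Prop :=
  forall x : R, 0 <= x < 1 -> `[0, 1[ `<=` closure (iet_orbit x).

End IntervalExchange.

Definition length_of (R : realType) (J : set R) : R :=
  fine (lebesgue_measure J).

(* There are finitely many n-block intervals, and at least one, so the
   infimum is a minimum. *)
Definition min_block (R : realType) (d : nat) (l : 'I_d -> R) (pi : 'S_d)
    (n : nat) : R :=
  inf [set length_of J | J in block_interval l pi n].

(* Main.v *)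
Require Import Defs.
From HB Require Import structures.
From mathcomp Require Import all_boot all_order all_algebra all_fingroup.
From mathcomp Require Import all_classical all_reals all_analysis.
From mathcomp Require Import measurable_realfun.
From mathcomp Require Import ring lra zify.

(** Why the discrepancies decay exponentially.

    Write T for the exchange, f for the indicator of J and P_w f for the mean
    of f over the first w points of an orbit.  Along the scales n_j with
    j > i + 4, replace f by its iterated averages F_(r+1) = P_w F_r, where w
    is one eighth of the current scale.  Since averages are composed instead
    of being taken over ever longer windows, no boundary terms appear: the
    oscillation of F_r never increases, its integral is constant, and its
    variance decreases by exactly the mean of the variance inside a window
    ([mean_bvar]).  The point is that the oscillation is halved after a number
    q of steps that depends only on c ([osc_halves]).

    Two facts about a scale n whose blocks are longer than e = c / n are used.
    Points of an orbit segment of length n / 2 are at distance more than e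
    from each other ([return_separated], an argument of Boshernitzan), and
    quantities that depend on fewer than n steps of the orbit are constant on
    the blocks of order n.  Hence a nonnegative quantity seen along an orbit
    segment contributes at least e times its sum along the segment to the
    Lebesgue integral ([orbit_sum_le_mean]).

    Suppose that the oscillation of F_(r+1) is still more than half of a bound
    M for that of F_r ([variance_drop]).  By minimality some orbit goes from
    the low values of F_(r+1) to the high ones, or back.  Cut this range into
    p bands.  A band that takes more than w / 2 steps to cross occupies a
    definite proportion of the unit interval, so for p large in terms of c at
    least one band is crossed faster ([slow_bands_few]).  Then two windows
    that overlap on half of their length have different means, so at least one
    of them has internal variance ([overlap_bvar]); this persists for a
    definite proportion of a window and makes the variance drop by a fixed
    multiple of M ^ 2 ([fast_band_variance]).  As the variance is at most
    M ^ 2 at the start, this cannot happen q times in a row.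

    Finally the means of f and of F_r over N points differ by at most the
    number of visits to J during the smoothing windows, divided by N
    ([discrepancy]); taking F_r at an intermediate scale makes both this error
    and the oscillation of F_r exponentially small compared with the length
    of J. *)

Set Implicit Arguments.
Unset Strict Implicit.
Unset Printing Implicit Defensive.

Import Order.TTheory GRing.Theory Num.Theory.
Import numFieldNormedType.Exports.

Local Open Scope classical_set_scope.
Local Open Scope ring_scope.

(** * Birkhoff averages *)

Section BirkhoffAverages.
Variables (R : realType) (X : Type) (T : X -> X).
Implicit Types (f g : X -> R) (x : X) (w k t : nat).

Definition birkhoff w f x : R := w%:R^-1 * \sum_(j < w) f (iter j T x).

Definition bvar w f x : R :=
  birkhoff w (fun y => (f y - birkhoff w f x) ^+ 2) x.

Lemma birkhoff_ge w f x lo : (0 < w)%N ->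
  (forall j, (j < w)%N -> lo <= f (iter j T x)) -> lo <= birkhoff w f x.
Proof.
move=> w0 fx; rewrite /birkhoff mulrC ler_pdivlMr ?ltr0n//.
have -> : lo * w%:R = \sum_(j < w) lo by rewrite sumr_const card_ord mulr_natr.
by apply: ler_sum => j _; exact: fx.
Qed.

Lemma birkhoff_le w f x hi : (0 < w)%N ->
  (forall j, (j < w)%N -> f (iter j T x) <= hi) -> birkhoff w f x <= hi.
Proof.
move=> w0 fx; rewrite /birkhoff mulrC ler_pdivrMr ?ltr0n//.
have -> : hi * w%:R = \sum_(j < w) hi by rewrite sumr_const card_ord mulr_natr.
by apply: ler_sum => j _; exact: fx.
Qed.

Lemma birkhoffC w k f x :
  birkhoff w (birkhoff k f) x = birkhoff k (birkhoff w f) x.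
Proof.
rewrite /birkhoff -!mulr_sumr !mulrA (mulrC w%:R^-1); congr (_ * _).
rewrite exchange_big; apply: eq_bigr => i _; apply: eq_bigr => j _.
by rewrite -!iterD addnC.
Qed.

Lemma sum_orbit_step w f x :
  \sum_(j < w) f (iter j T (T x)) =
  \sum_(j < w) f (iter j T x) + f (iter w T x) - f x.
Proof.
have := big_ord_recl (R := R) (idx := 0) (op := +%R) w (fun j => f (iter j T x)).
rewrite big_ord_recr /= => ->; rewrite [RHS]addrC addKr.
by apply: eq_bigr => j _; rewrite -iterSr.
Qed.

Lemma sum_orbit_shift w s f x :
  \sum_(j < w) f (iter j T (iter s T x)) =
  \sum_(j < w) f (iter j T x) +
  (\sum_(j < s) f (iter j T (iter w T x)) - \sum_(j < s) f (iter j T x)).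
Proof.
elim: s => [|s IH]; first by rewrite !big_ord0 subrr addr0.
rewrite iterS sum_orbit_step IH !big_ord_recr /= -!iterD (addnC w s); ring.
Qed.

(** The mean over w points changes by at most M / w when the window moves by
    one step: only the two end terms differ. *)
Lemma birkhoff_lipschitz w f x (M : R) :
  (forall j k, `|f (iter j T x) - f (iter k T x)| <= M) ->
  forall k, `|birkhoff w f (iter k T x) - birkhoff w f x| <= k%:R * (M / w%:R).
Proof.
move=> fM; elim=> [|k IH]; first by rewrite subrr normr0 mul0r.
have step : `|birkhoff w f (iter k.+1 T x) - birkhoff w f (iter k T x)| <=
    M / w%:R.
  rewrite /birkhoff iterS sum_orbit_step -mulrBr.
  rewrite [X in _ * X](_ : _ = f (iter w T (iter k T x)) - f (iter k T x));
    last by ring.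
  rewrite normrM normfV normr_nat mulrC.
  by apply: ler_wpM2r; rewrite ?invr_ge0 ?ler0n// -iterD.
have -> : k.+1%:R * (M / w%:R) = M / w%:R + k%:R * (M / w%:R) by rewrite -natr1; ring.
apply: le_trans (lerD step IH).
by apply: le_trans (ler_normD _ _); rewrite addrA subrK.
Qed.

Lemma bvar_ge0 w f x : 0 <= bvar w f x.
Proof. by rewrite mulr_ge0 ?invr_ge0// sumr_ge0// => j _; rewrite sqr_ge0. Qed.

Lemma bvarE w f x : (0 < w)%N ->
  bvar w f x = birkhoff w (fun y => f y ^+ 2) x - birkhoff w f x ^+ 2.
Proof.
move=> w0; rewrite {1}/bvar; set m := birkhoff w f x.
have wN0 : w%:R != 0 :> R by rewrite pnatr_eq0 -lt0n.
have E1 : \sum_(j < w) f (iter j T x) = w%:R * m by rewrite /m mulVKf.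
have -> : birkhoff w (fun y => (f y - m) ^+ 2) x =
    birkhoff w (fun y => f y ^+ 2) x - 2 * m * birkhoff w f x + m ^+ 2.
  rewrite /birkhoff (eq_bigr (fun j : 'I_w => f (iter j T x) ^+ 2 +
    (- (2 * m)) * f (iter j T x) + m ^+ 2)); last by move=> j _; ring.
  rewrite !big_split /= sumr_const card_ord -mulr_sumr -(mulr_natl (m ^+ 2)).
  by field.
by rewrite -/m; ring.
Qed.

(** Two windows that overlap on at least half of their length cannot both be
    almost constant and have different means: on the overlap the values would
    be close to both means. *)
Lemma overlap_bvar w t f x : (0 < w)%N -> (2 * t <= w)%N ->
  (birkhoff w f (iter t T x) - birkhoff w f x) ^+ 2 <=
  4 * (bvar w f x + bvar w f (iter t T x)).
Proof.
move=> w0 tw; have w0R : 0 < w%:R :> R by rewrite ltr0n.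
set m := birkhoff w f x; set m' := birkhoff w f (iter t T x).
pose a j := f (iter j T x).
have V1 : \sum_(t <= j < w) (a j - m) ^+ 2 <= w%:R * bvar w f x.
  rewrite /bvar /birkhoff mulVKf ?gt_eqF// -/(birkhoff w f x).
  rewrite -(big_mkord xpredT (fun j => (a j - m) ^+ 2)).
  rewrite [leRHS](big_cat_nat (n := t)) ?leq0n //=; last by lia.
  by rewrite lerDr sumr_ge0// => j _; rewrite sqr_ge0.
have V2 : \sum_(t <= j < w) (a j - m') ^+ 2 <= w%:R * bvar w f (iter t T x).
  rewrite /bvar /birkhoff mulVKf ?gt_eqF// -/(birkhoff w f (iter t T x)).
  rewrite -(big_mkord xpredT (fun j => (f (iter j T (iter t T x)) - m') ^+ 2)).
  rewrite [leRHS](big_cat_nat (n := w - t)) ?leq0n ?leq_subr //=.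
  rewrite -{1}(add0n t) big_addn.
  under eq_bigr do rewrite /a iterD.
  by rewrite lerDl sumr_ge0// => j _; rewrite sqr_ge0.
have key : \sum_(t <= j < w) (m' - m) ^+ 2 <=
    2 * (\sum_(t <= j < w) (a j - m) ^+ 2 + \sum_(t <= j < w) (a j - m') ^+ 2).
  rewrite -big_split mulr_sumr /=; apply: ler_sum => j _.
  have := sqr_ge0 (a j - m + (a j - m')); nra.
rewrite sumr_const_nat in key.
have tw' : (w%:R : R) <= 2 * (w - t)%:R.
  by rewrite -natrM ler_nat; lia.
rewrite -mulr_natl in key.
have sq := sqr_ge0 (m' - m).
rewrite -(ler_pM2l w0R); nra.
Qed.

End BirkhoffAverages.

(** * Crossing a band *)

(** The sequence stays strictly inside the band between the first time j1 at or
    above the upper threshold and the last time j0 before j1 at or below the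
    lower one. *)
Lemma upcrossing (R : realType) (s : nat -> R) (lo hi : R) (k : nat) :
  lo < hi -> s 0 <= lo -> hi <= s k ->
  exists j0 j1, [/\ (j0 < j1 <= k)%N, s j0 <= lo, hi <= s j1 &
    forall j, (j0 < j < j1)%N -> lo < s j < hi].
Proof.
move=> lohi s0 sk.
have ex1 : exists j, hi <= s j by exists k.
case: (ex_minnP ex1) => j1 hj1 minj1.
have j1k : (j1 <= k)%N by exact: minj1.
have j10 : (0 < j1)%N.
  by rewrite lt0n; apply/eqP => j10; move: hj1; rewrite j10; lra.
pose P j := (j < j1)%N && (s j <= lo).
have ex0 : exists j, P j by exists 0%N; rewrite /P j10.
have ub j : P j -> (j <= j1)%N by case/andP => /ltnW.
case: (ex_maxnP ex0 ub) => j0 /andP[j01 sj0] maxj0.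
exists j0, j1; split=> //; first by rewrite j01.
move=> j /andP[j0j jj1]; apply/andP; split.
  by rewrite ltNge; apply/negP => sj; have := maxj0 j; rewrite /P jj1 sj; lia.
by rewrite ltNge; apply/negP => sj; have := minj1 j sj; lia.
Qed.

(** Minimality gives an orbit joining a low value to a high one without
    telling which of the two comes first. *)
Lemma band_crossing (R : realType) (s : nat -> R) (lo hi : R) (k : nat) :
  lo < hi -> (s 0 <= lo /\ hi <= s k) \/ (hi <= s 0 /\ s k <= lo) ->
  exists j0 j1, [/\ (j0 < j1 <= k)%N, hi - lo <= `|s j1 - s j0| &
    forall j, (j0 < j < j1)%N -> lo < s j < hi].
Proof.
move=> lohi [[s0 sk]|[s0 sk]].
  have [j0 [j1 [j01 h0 h1 h]]] := upcrossing lohi s0 sk.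
  exists j0, j1; split=> //.
  by apply: le_trans (ler_norm _); lra.
have [||| j0 [j1 [j01 h0 h1 h]]] :=
    @upcrossing R (fun j => - s j) (- hi) (- lo) k; rewrite ?ltrN2 ?lerN2//.
exists j0, j1; split=> //.
  by rewrite distrC; apply: le_trans (ler_norm _); lra.
by move=> j /h /andP[]; rewrite !ltrN2 => -> ->.
Qed.

(** * The mean over the unit interval *)

Section MeanOverUnitInterval.
Variable R : realType.
Implicit Types (f g : R -> R) (a b e : R).

Local Notation mu := (@lebesgue_measure R).
Local Notation I01 := (`[0, 1[%classic : set R).

(** Measurable functions bounded on the whole line form a class stable under
    all the operations below, and every member is integrable on [0, 1). *)
Definition bmeas f :=
  measurable_fun [set: R] f /\ exists M : R, forall x, `|f x| <= M.

Definition mean f : R := \int[mu]_(x in I01) f x.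

Lemma mu01 : mu I01 = 1%E.
Proof. by rewrite lebesgue_measure_itv/= lte_fin ltr01 sube0. Qed.

Lemma bmeas_integrable f : bmeas f -> mu.-integrable I01 (EFin \o f).
Proof.
case=> mf [M fM]; apply: measurable_bounded_integrable => //.
- by rewrite /= mu01 ltry.
- exact: measurable_funS mf.
- by exists M; split; [exact: num_real|move=> A MA x _; apply: le_trans (fM x) (ltW MA)].
Qed.

Lemma bmeas_cst a : bmeas (fun=> a).
Proof. by split; [exact: measurable_cst|exists `|a|]. Qed.

Lemma bmeasD f g : bmeas f -> bmeas g -> bmeas (fun x => f x + g x).
Proof.
move=> [mf [M fM]] [mg [N gN]]; split; first exact: measurable_funD.
by exists (M + N) => x; apply: le_trans (ler_normD _ _) (lerD _ _).
Qed.

Lemma bmeasM f g : bmeas f -> bmeas g -> bmeas (fun x => f x * g x).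
Proof.
move=> [mf [M fM]] [mg [N gN]]; split; first exact: measurable_funM.
by exists (M * N) => x; rewrite normrM ler_pM.
Qed.

Lemma bmeasB f g : bmeas f -> bmeas g -> bmeas (fun x => f x - g x).
Proof.
move=> hf hg; rewrite (_ : (fun x => _) = (fun x => f x + -1 * g x)).
  by apply: bmeasD => //; apply: bmeasM => //; exact: bmeas_cst.
by apply/funext => x; rewrite mulN1r.
Qed.

Lemma bmeas_sum n (F : nat -> R -> R) :
  (forall i, (i < n)%N -> bmeas (F i)) -> bmeas (fun x => \sum_(i < n) F i x).
Proof.
elim: n => [|n IH] hF.
  by under eq_fun do rewrite big_ord0; exact: bmeas_cst.
under eq_fun do rewrite big_ord_recr; apply: bmeasD; last exact: hF.
by apply: IH => i ilt; apply: hF; exact: ltnW.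
Qed.

Lemma bmeas_indic (A : set R) : measurable A -> bmeas \1_A.
Proof.
move=> mA; split; first exact: measurable_indic.
by exists 1 => x; rewrite indicE; case: (_ \in _); rewrite ?normr1 ?normr0.
Qed.

Lemma bmeas_comp f (T : R -> R) : measurable_fun [set: R] T ->
  bmeas f -> bmeas (f \o T).
Proof.
by move=> mT [mf [M fM]]; split; [exact: measurableT_comp|exists M => x /=].
Qed.

Lemma mean_le f g : bmeas f -> bmeas g ->
  (forall x, 0 <= x < 1 -> f x <= g x) -> mean f <= mean g.
Proof.
move=> /bmeas_integrable hf /bmeas_integrable hg fg.
by apply: le_Rintegral => // x; rewrite /= in_itv/=; exact: fg.
Qed.

Lemma mean_cst a : mean (fun=> a) = a.
Proof. by rewrite /mean Rintegral_cst//= mu01 mulr1. Qed.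

Lemma meanD f g : bmeas f -> bmeas g ->
  mean (fun x => f x + g x) = mean f + mean g.
Proof.
by move=> /bmeas_integrable hf /bmeas_integrable hg; exact: RintegralD.
Qed.

Lemma meanZ a f : bmeas f -> mean (fun x => a * f x) = a * mean f.
Proof. by move=> /bmeas_integrable hf; exact: RintegralZl. Qed.

Lemma meanB f g : bmeas f -> bmeas g ->
  mean (fun x => f x - g x) = mean f - mean g.
Proof.
by move=> /bmeas_integrable hf /bmeas_integrable hg; exact: RintegralB.
Qed.

Lemma mean_sum n (F : nat -> R -> R) :
  (forall i, (i < n)%N -> bmeas (F i)) ->
  mean (fun x => \sum_(i < n) F i x) = \sum_(i < n) mean (F i).
Proof.
elim: n => [|n IH] hF.
  by rewrite big_ord0; under eq_fun do rewrite big_ord0; rewrite mean_cst.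
under eq_fun do rewrite big_ord_recr; rewrite big_ord_recr /= meanD ?IH//.
- by move=> i ilt; apply: hF; exact: ltnW.
- by apply: bmeas_sum => i ilt; apply: hF; exact: ltnW.
- exact: hF.
Qed.

Lemma mean_indic_itv a b : 0 <= a -> a < b -> b <= 1 ->
  mean \1_(`[a, b[ : set R) = b - a.
Proof.
move=> a0 ab b1; rewrite /mean /Rintegral integral_indic//.
have -> : `[a, b[ `&` I01 = `[a, b[%classic.
  apply/setIidPl => x; rewrite /= !in_itv/= => /andP[ax xb].
  by rewrite (le_trans a0 ax) (lt_le_trans xb b1).
by rewrite /= lebesgue_measure_itv/= lte_fin ab -EFinB.
Qed.

Lemma lebesgue_measure_translation (t : R) (A : set R) : measurable A ->
  mu ((fun x => x + t) @^-1` A) = mu A.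
Proof.
have mt : measurable_fun [set: measurableTypeR R]
    ((fun x => x + t) : _ -> measurableTypeR R).
  by apply: measurable_funD.
pose s : {mfun measurableTypeR R >-> measurableTypeR R} :=
  HB.pack ((fun x => x + t) : _ -> measurableTypeR R)
   (isMeasurableFun.Build _ _ _ _ _ mt).
move=> mA; apply/esym.
apply: (@lebesgue_measure_unique R (pushforward mu s)) => //= _ [[a b]] _ <-.
rewrite /pushforward /=.
have -> : (fun x => x + t) @^-1` `]a, b] = `]a - t, b - t]%classic.
  by apply/seteqP; split => x /=; rewrite !in_itv/= ltrBlDr lerBrDr.
rewrite !lebesgue_measure_itv/= !lte_fin ltrD2r; case: ifP => // _.
by rewrite -!EFinB; congr EFin; ring.
Qed.

Lemma mean_comp (T : R -> R) f : measurable_fun [set: R] T ->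
  (forall A : set R, measurable A -> A `<=` I01 -> mu (T @^-1` A) = mu A) ->
  T @^-1` I01 = I01 -> bmeas f -> mean (f \o T) = mean f.
Proof.
move=> mT muT T01 hf; rewrite /mean /Rintegral; congr fine.
rewrite -{1}T01.
have mT' : measurable_fun [set: measurableTypeR R] (T : _ -> measurableTypeR R).
  exact: mT.
have mf : measurable_fun [set: measurableTypeR R] (EFin \o f).
  by apply/measurable_EFinP; case: hf.
rewrite -(@integral_pushforward _ _ (measurableTypeR R) (measurableTypeR R) R T mT' lebesgue_measure I01 (EFin \o f))//.
- by apply: eq_measure_integral => A mA A01; exact: muT.
- rewrite T01; apply: (@bmeas_integrable (f \o T)); exact: bmeas_comp.
Qed.

Section Invariant.
Variable T : R -> R.
Hypothesis mT : measurable_fun [set: R] T.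
Hypothesis inv : forall f, bmeas f -> mean (f \o T) = mean f.

Lemma bmeas_iter f k : bmeas f -> bmeas (f \o iter k T).
Proof.
elim: k f => [|k IH] f hf; first exact: hf.
by have := IH _ (bmeas_comp mT hf).
Qed.

Lemma mean_iter f k : bmeas f -> mean (f \o iter k T) = mean f.
Proof.
elim: k f => [|k IH] f hf; first by [].
by rewrite -(inv hf) -(IH _ (bmeas_comp mT hf)).
Qed.

Lemma bmeas_birkhoff w f : bmeas f -> bmeas (birkhoff T w f).
Proof.
move=> hf; apply: (@bmeasM (fun=> w%:R^-1)); first exact: bmeas_cst.
by apply: (@bmeas_sum w (fun j => f \o iter j T)) => j _; exact: bmeas_iter.
Qed.

Lemma mean_birkhoff w f : (0 < w)%N -> bmeas f ->
  mean (birkhoff T w f) = mean f.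
Proof.
move=> w0 hf; rewrite /birkhoff meanZ; last first.
  by apply: (@bmeas_sum w (fun j => f \o iter j T)) => j _; exact: bmeas_iter.
rewrite (@mean_sum w (fun j => f \o iter j T)); last first.
  by move=> j _; exact: bmeas_iter.
under eq_bigr do rewrite mean_iter//.
by rewrite sumr_const card_ord -[X in _ * X]mulr_natl mulKf// pnatr_eq0 -lt0n.
Qed.

Lemma bmeas_sqr f : bmeas f -> bmeas (fun x => f x ^+ 2).
Proof. by move=> hf; apply: bmeasM. Qed.

Lemma bmeas_bvar w f : (0 < w)%N -> bmeas f -> bmeas (bvar T w f).
Proof.
move=> w0 hf; rewrite (_ : bvar T w f = fun x =>
    birkhoff T w (fun y => f y ^+ 2) x - birkhoff T w f x ^+ 2); last first.
  by apply/funext => x; rewrite bvarE.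
by apply: bmeasB; [apply/bmeas_birkhoff/bmeas_sqr|apply/bmeas_sqr/bmeas_birkhoff].
Qed.

(** Law of total variance.  By invariance, averaging the squares over a window
    does not change their mean; the difference with the square of the average
    is the variance inside the window. *)
Lemma mean_bvar w f : (0 < w)%N -> bmeas f ->
  mean (bvar T w f) =
  mean (fun x => f x ^+ 2) - mean (fun x => birkhoff T w f x ^+ 2).
Proof.
move=> w0 hf; rewrite (_ : bvar T w f = fun x =>
    birkhoff T w (fun y => f y ^+ 2) x - birkhoff T w f x ^+ 2); last first.
  by apply/funext => x; rewrite bvarE.
rewrite meanB ?mean_birkhoff//; first exact: bmeas_sqr.
  by apply/bmeas_birkhoff/bmeas_sqr.
by apply/bmeas_sqr/bmeas_birkhoff.
Qed.

End Invariant.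
End MeanOverUnitInterval.

(** * The exchanged intervals *)

Section IntervalPartition.
Variables (R : realType) (d : nat).
Implicit Types (l : 'I_d -> R) (j k : 'I_d) (x : R).

Lemma iet_left_lt l j k : (forall i, 0 <= l i) -> (j < k)%N ->
  iet_left l j + l j <= iet_left l k.
Proof.
move=> l0 jk; rewrite /iet_left [leRHS](bigD1 j)//= [leRHS]addrC lerD2r.
rewrite [leRHS](bigID (fun i : 'I_d => (i < j)%N)) /=.
rewrite -[leLHS]addr0; apply: lerD; last exact: sumr_ge0.
rewrite le_eqVlt; apply/orP; left; apply/eqP; apply: eq_bigl => i.
have [->|] := eqVneq i j; first by rewrite ltnn !andbF.
by move=> _; rewrite andbT; case: ltnP => [ij|]; rewrite ?andbF// (ltn_trans ij jk).
Qed.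

Lemma iet_left_ge0 l j : (forall i, 0 <= l i) -> 0 <= iet_left l j.
Proof. by move=> l0; exact: sumr_ge0. Qed.

Lemma iet_right_le l j : (forall i, 0 <= l i) ->
  iet_left l j + l j <= \sum_(k < d) l k.
Proof.
move=> l0; rewrite /iet_left [leRHS](bigD1 j)//= [leLHS]addrC lerD2l.
rewrite [leRHS](bigID (fun i : 'I_d => (i < j)%N)) /=.
rewrite -[leLHS]addr0; apply: lerD; last exact: sumr_ge0.
rewrite le_eqVlt; apply/orP; left; apply/eqP; apply: eq_bigl => i.
by have [->|] := eqVneq i j; rewrite ?ltnn.
Qed.

Lemma iet_itv_inj l j k x : (forall i, 0 <= l i) ->
  x \in iet_itv l j -> x \in iet_itv l k -> j = k.
Proof.
move=> l0; rewrite /iet_itv !in_itv/= => /andP[jx xj] /andP[kx xk].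
apply/val_inj/eqP; case: ltngtP => // jk.
  by have := iet_left_lt l0 jk; lra.
by have := iet_left_lt l0 jk; lra.
Qed.

Lemma iet_itv_cover l x : (forall i, 0 <= l i) -> \sum_(k < d) l k = 1 ->
  0 <= x < 1 -> exists j, x \in iet_itv l j.
Proof.
move=> l0 l1 /andP[x0 x1].
pose s (m : nat) := \sum_(k < d | (k < m)%N) l k.
have ex : exists m, x < s m.
  exists d; rewrite /s (eq_bigl xpredT) ?l1// => k; exact: ltn_ord.
case: (ex_minnP ex) => m xm minm.
case: m xm minm => [|m] xm minm.
  by move: xm; rewrite /s big_pred0_eq ltNge x0.
have md : (m < d)%N.
  rewrite ltnNge; apply/negP => dm; have := minm m.
  rewrite ltnn => mm; apply: (Bool.diff_false_true); apply: mm.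
  apply: lt_le_trans xm _; rewrite /s.
  rewrite le_eqVlt; apply/orP; left; apply/eqP; apply: eq_bigl => k.
  by rewrite (leq_trans (ltn_ord k) dm) ltnS ltnW// (leq_trans (ltn_ord k) dm).
exists (Ordinal md); rewrite /iet_itv in_itv/=; apply/andP; split.
  by rewrite leNgt; apply/negP => /minm; rewrite ltnn.
apply: lt_le_trans xm _; rewrite /s /iet_left (bigD1 (Ordinal md))//= addrC lerD2r.
rewrite le_eqVlt; apply/orP; left; apply/eqP; apply: eq_bigl => k.
by rewrite ltnS -val_eqE /= ltn_neqAle andbC.
Qed.

End IntervalPartition.

(** * The exchange map *)

Section IntervalExchangeMap.
Variables (R : realType) (d : nat) (l : 'I_d -> R) (pi : 'S_d).
Hypothesis l_ge0 : forall k, 0 <= l k.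
Hypothesis l_sum : \sum_(k < d) l k = 1.
Implicit Types (x y e : R).

Local Notation T := (iet l pi).
Local Notation I01 := (`[0, 1[%classic : set R).

(** The image intervals are again laid out side by side, in the order given
    by pi: they are the cells of the partition for the permuted lengths. *)
Definition image_lengths : 'I_d -> R := fun i => l ((pi^-1)%g i).

Lemma image_lengths_ge0 i : 0 <= image_lengths i.
Proof. exact: l_ge0. Qed.

Lemma image_lengths_sum : \sum_(k < d) image_lengths k = 1.
Proof.
rewrite -l_sum (reindex_inj (@perm_inj _ pi)) /=.
by apply: eq_bigr => i _; rewrite /image_lengths permK.
Qed.

Lemma image_left (j : 'I_d) :
  \sum_(k < d | (pi k < pi j)%N) l k = iet_left image_lengths (pi j).
Proof.
rewrite /iet_left [RHS](reindex_inj (@perm_inj _ pi)) /=.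
by apply: eq_bigr => i _; rewrite /image_lengths permK.
Qed.

Lemma image_length (j : 'I_d) : image_lengths (pi j) = l j.
Proof. by rewrite /image_lengths permK. Qed.

Definition iet_shift (j : 'I_d) : R := iet_left image_lengths (pi j) - iet_left l j.

Lemma ietE (j : 'I_d) x : x \in iet_itv l j -> T x = x + iet_shift j.
Proof.
move=> xj; rewrite /iet; case: pickP => [k xk|/(_ j)]; last by rewrite xj.
rewrite (iet_itv_inj l_ge0 xk xj) image_left /iet_shift; ring.
Qed.

Lemma iet_image_itv (j : 'I_d) x :
  x \in iet_itv l j -> T x \in iet_itv image_lengths (pi j).
Proof.
move=> xj; rewrite (ietE xj); move: xj.
by rewrite /iet_itv !in_itv/= image_length /iet_shift; lra.
Qed.

Lemma iet01 x : 0 <= x < 1 -> 0 <= T x < 1.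
Proof.
move=> /(iet_itv_cover l_ge0 l_sum)[j /iet_image_itv].
have := iet_left_ge0 (pi j) image_lengths_ge0.
have := iet_right_le (pi j) image_lengths_ge0.
by rewrite image_lengths_sum /iet_itv in_itv/=; lra.
Qed.

Lemma iet_out x : ~~ (0 <= x < 1) -> T x = x.
Proof.
move=> x01; rewrite /iet; case: pickP => // j xj; case/negP: x01; move: xj.
have := iet_left_ge0 j l_ge0; have := iet_right_le j l_ge0.
by rewrite l_sum /iet_itv in_itv/=; lra.
Qed.

Lemma iter_iet01 (n : nat) x : 0 <= x < 1 -> 0 <= iter n T x < 1.
Proof. by move=> x01; elim: n => //= n; exact: iet01. Qed.

Lemma iet_inj x y : 0 <= x < 1 -> 0 <= y < 1 -> T x = T y -> x = y.
Proof.
move=> /(iet_itv_cover l_ge0 l_sum)[j xj] /(iet_itv_cover l_ge0 l_sum)[k yk] E.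
have kx := iet_image_itv yk; rewrite -E in kx.
have /perm_inj jk := iet_itv_inj image_lengths_ge0 (iet_image_itv xj) kx.
by move: E; rewrite (ietE xj) (ietE yk) jk => /addIr.
Qed.

Lemma iter_iet_inj (n : nat) x y : 0 <= x < 1 -> 0 <= y < 1 ->
  iter n T x = iter n T y -> x = y.
Proof.
move=> x01 y01; elim: n => //= n IH E; apply: IH.
by apply: iet_inj E; exact: iter_iet01.
Qed.

(** T adds to x a step function of x, which also vanishes outside [0, 1). *)
Lemma measurable_iet : measurable_fun [set: R] T.
Proof.
rewrite (_ : (T : R -> R) = fun x => x +
    \sum_(j <- index_enum 'I_d) iet_shift j * \1_[set` iet_itv l j] x).
  apply: measurable_funD => //; apply: measurable_sum => j.
  by apply: measurable_funM => //; exact: measurable_indic.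
apply/funext => x.
have indE j : \1_[set` iet_itv l j] x = (x \in iet_itv l j)%:R :> R.
  by rewrite indicE mem_setE.
have [[j xj]|none] := pselect (exists j, x \in iet_itv l j); last first.
  rewrite /iet; case: pickP => [j xj|_]; first by case: none; exists j.
  rewrite big1 ?addr0// => j _; rewrite indE.
  case: (boolP (x \in iet_itv l j)) => xj; last by rewrite mulr0.
  by case: none; exists j.
rewrite (ietE xj) (bigD1 j)//= indE xj mulr1 big1 ?addr0// => k kj.
rewrite indE; case: (boolP (x \in iet_itv l k)) => xk; last by rewrite mulr0.
by rewrite (iet_itv_inj l_ge0 xj xk) eqxx in kj.
Qed.

Lemma iet_preimage01 : T @^-1` I01 = I01.
Proof.
apply/seteqP; split => x /=; rewrite !in_itv/=; last exact: iet01.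
by apply: contraLR => /[dup] /iet_out ->.
Qed.

(** The preimage of A is cut by the exchanged intervals into translates of the
    pieces cut from A by the image intervals. *)
Lemma iet_preserves_lebesgue (A : set R) : measurable A -> A `<=` I01 ->
  lebesgue_measure (T @^-1` A) = lebesgue_measure A.
Proof.
move=> mA A01.
pose B j := A `&` [set` iet_itv image_lengths (pi j)].
pose C j := (fun x => x + iet_shift j) @^-1` B j.
have mB j : measurable (B j) by exact: measurableI.
have mC j : measurable (C j).
  rewrite /C -[X in measurable X]setTI.
  apply: (_ : measurable_fun setT (fun x : R => x + iet_shift j)) => //.
  exact: measurable_funD.
have BE : A = \bigcup_(j in [set: 'I_d]) B j.
  apply/seteqP; split => [x Ax|x [j _ []]//].
  have := A01 x Ax; rewrite /= in_itv/=.
  move=> /(iet_itv_cover image_lengths_ge0 image_lengths_sum)[k xk].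
  by exists ((pi^-1)%g k) => //; split=> //; rewrite permKV.
have aux j x : x + iet_shift j \in iet_itv image_lengths (pi j) ->
    x \in iet_itv l j.
  by rewrite /iet_itv !in_itv/= image_length /iet_shift; lra.
have CE : T @^-1` A = \bigcup_(j in [set: 'I_d]) C j.
  apply/seteqP; split => [x Ax|x [j _ [Ax /= xj]]].
    have : I01 x by rewrite -iet_preimage01; exact: A01.
    rewrite /= in_itv/= => /(iet_itv_cover l_ge0 l_sum)[j xj].
    exists j => //; rewrite /C/B/=; split; first by rewrite -ietE.
    by rewrite -ietE//; exact: iet_image_itv.
  by rewrite /= (@ietE j)//; exact: aux.
have Binj : trivIset [set: 'I_d] B.
  move=> j k _ _ [x [[_ xj] [_ xk]]].
  by apply: (@perm_inj _ pi); exact: iet_itv_inj image_lengths_ge0 xj xk.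
have Cinj : trivIset [set: 'I_d] C.
  by move=> j k _ _ [x [[_ /aux xj] [_ /aux xk]]]; exact: iet_itv_inj xj xk.
rewrite CE [in RHS]BE !measure_fin_bigcup//; try exact: finite_finset.
- by apply: eq_fsbigr => j _; exact: lebesgue_measure_translation.
- by move=> j _; exact: mB.
- by move=> j _; exact: mC.
Qed.

Lemma mean_iet (f : R -> R) : bmeas f -> mean (f \o T) = mean f.
Proof.
apply: mean_comp; first exact: measurable_iet.
  exact: iet_preserves_lebesgue.
exact: iet_preimage01.
Qed.

(** * Block intervals *)

Local Notation D := (iet_iter_disc l pi).

Definition adjacent (n : nat) (a b : R) : Prop :=
  [/\ D n a, D n b, a < b & forall y, a < y < b -> ~ D n y].

Lemma iet_iter_disc01 n y : D n y -> 0 <= y <= 1.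
Proof.
case=> [[] -> |[i _ [/= + _]]]; rewrite ?lexx ?ler01//.
by rewrite in_itv/= => /andP[-> /ltW].
Qed.

Lemma iet_iter_disc_sub m n y : (m <= n)%N -> D m y -> D n y.
Proof.
move=> mn [|[i im h]]; [by left|right; exists i => //=].
exact: leq_trans im mn.
Qed.

Lemma iet_iter_disc_intro n i y : (i < n)%N -> 0 <= y < 1 ->
  iet_disc l (iter i T y) -> D n y.
Proof. by move=> ilt y01 h; right; exists i => //; split=> //=; rewrite in_itv. Qed.

Lemma iet_iter_disc_elim n y : D n y -> 0 < y < 1 ->
  exists2 i, (i < n)%N & iet_disc l (iter i T y).
Proof.
case=> [[] -> |[i im [_ h]] _]; rewrite ?ltxx ?andbF//.
by exists i.
Qed.

Lemma finite_iet_iter_disc n : finite_set (D n).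
Proof.
have fdisc : finite_set (iet_disc l).
  by apply: finite_image; exact: finite_finset.
rewrite /iet_iter_disc finite_setU; split; first exact: finite_set2.
apply: bigcup_finite => [|i _]; first exact: finite_II.
have inj : {in I01 `&` iter i T @^-1` iet_disc l &, injective (iter i T)}.
  move=> x y /set_mem[/= + _] /set_mem[/= + _]; rewrite !in_itv/=.
  exact: iter_iet_inj.
rewrite -(eq_finite_set (inj_card_eq inj)).
by apply: sub_finite_set fdisc => _ [y [_ hy] <-].
Qed.

(** Induction on s, shrinking the bracket at each new point. *)
Lemma bracketing (x p q : R) (s : seq R) : p <= x < q ->
  exists a b, [/\ a \in [:: p, q & s], b \in [:: p, q & s], a <= x < b &
    forall y, y \in s -> ~~ (a < y < b)].
Proof.
move=> pxq; elim: s => [|y s [a [b [ain bin axb ab]]]].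
  by exists p, q; rewrite !inE !eqxx orbT.
have mono z : z \in [:: p, q & s] -> z \in [:: p, q, y & s].
  by rewrite !inE => /or3P[->|->|->]; rewrite ?orbT.
have [yx|xy] := lerP y x.
  exists (Num.max a y), b; split=> //; last 1 first.
  - move=> z; rewrite inE => /predU1P[->|/ab]; rewrite gt_max ?ltxx ?andbF//.
    by apply: contra => /andP[/andP[-> _] ->].
  - by rewrite maxEle; case: ifP => _; rewrite ?(mono _ ain)// !inE eqxx !orbT.
  - exact: mono.
  - by rewrite ge_max yx andbT.
exists a, (Num.min b y); split=> //; last 1 first.
- move=> z; rewrite inE => /predU1P[->|/ab]; rewrite lt_min ?ltxx ?andbF//.
  by apply: contra => /andP[-> /andP[-> _]].
- exact: mono.
- by rewrite minEle; case: ifP => _; rewrite ?(mono _ bin)// !inE eqxx !orbT.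
- by rewrite lt_min xy andbT.
Qed.


Lemma exists_block n x : 0 <= x < 1 ->
  exists a b, adjacent n a b /\ a <= x < b.
Proof.
move=> x01; have /finite_seqP[s Ds] := finite_iet_iter_disc n.
have [a [b [ain bin axb ab]]] := bracketing s x01.
have Din y : y \in [:: 0, 1 & s] -> D n y.
  rewrite !inE => /or3P[/eqP->|/eqP->|ys]; [by left; left|by left; right|].
  by rewrite Ds.
exists a, b; split=> //; split; [exact: Din|exact: Din|lra|].
by move=> y yab; rewrite Ds => /ab; rewrite yab.
Qed.

Lemma block01 n a b x : adjacent n a b -> a <= x < b -> 0 <= x < 1.
Proof. by move=> [/iet_iter_disc01 ? /iet_iter_disc01 ? _ _]; lra. Qed.

(** Two points of different exchanged intervals are separated by the left end
    point of the right-hand one, which is a discontinuity. *)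
Lemma iet_translation_le (a b x y : R) : 0 <= a -> b <= 1 ->
  (forall z, a < z < b -> ~ iet_disc l z) -> a <= x -> x <= y -> y < b ->
  T y - y = T x - x.
Proof.
move=> a0 b1 nodisc ax xy yb.
have [j xj] : exists j, x \in iet_itv l j.
  by apply: iet_itv_cover => //; lra.
have [k yk] : exists j, y \in iet_itv l j.
  by apply: iet_itv_cover => //; lra.
rewrite (ietE xj) (ietE yk) !(addrC _ (iet_shift _)) !addrK; congr iet_shift.
apply/val_inj/eqP; case: ltngtP => // jk; move: xj yk; rewrite !in_itv/=.
  by have := iet_left_lt l_ge0 jk; lra.
move=> /andP[_ xj] /andP[ky _]; exfalso; have := iet_left_lt l_ge0 jk => jk'.
apply: (nodisc (iet_left l k)); first by lra.
by exists k => //=; exact: leq_ltn_trans (leq0n _) jk.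
Qed.

Lemma iet_translation (a b x y : R) : 0 <= a -> b <= 1 ->
  (forall z, a < z < b -> ~ iet_disc l z) -> a <= x < b -> a <= y < b ->
  T y - y = T x - x.
Proof.
move=> a0 b1 nodisc /andP[ax xb] /andP[ay yb]; have [xy|/ltW yx] := lerP x y.
  exact: (iet_translation_le a0 b1 nodisc).
by apply/esym; exact: (iet_translation_le a0 b1 nodisc).
Qed.

(** The images of a block up to time n - 1 meet no discontinuity in their
    interior, so each further step translates them as a whole. *)
Lemma block_translation n a b j u : adjacent n a b -> (j <= n)%N ->
  a <= u < b -> iter j T u = iter j T a + (u - a).
Proof.
move=> adj; have [Da Db ab noD] := adj.
elim: j u => [|j IH] u jn uab; first by rewrite /= addrC subrK.
have {}IH v : a <= v < b -> iter j T v = iter j T a + (v - a).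
  by apply: IH; exact: ltnW.
have aab : a <= a < b by rewrite lexx.
have in01 v : a <= v < b -> 0 <= iter j T v < 1.
  by move=> /(block01 adj); exact: iter_iet01.
pose p := iter j T a.
have p0 : 0 <= p by case/andP: (in01 _ aab).
have q1 : p + (b - a) <= 1.
  rewrite leNgt; apply/negP => q1.
  (* A point of the block whose image would lie at or beyond 1. *)
  have h : a <= Num.max a (b - (p + (b - a) - 1) / 2) < b.
    by rewrite le_max lexx gt_max ab /=; lra.
  have := in01 _ h; rewrite (IH _ h) -/p => /andP[_].
  have : b - (p + (b - a) - 1) / 2 <= Num.max a (b - (p + (b - a) - 1) / 2).
    by rewrite le_max lexx orbT.
  by lra.
have nodisc z : p < z < p + (b - a) -> ~ iet_disc l z.
  move=> zp dz; apply: (noD (a + (z - p))); first by lra.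
  have h : a <= a + (z - p) < b by lra.
  apply: (iet_iter_disc_intro jn); first exact: block01 adj h.
  by rewrite IH//; congr (iet_disc l _): dz; rewrite /p; ring.
rewrite !iterS -/p.
have := iet_translation p0 q1 nodisc (x := p) (y := iter j T u).
rewrite IH// -/p => E.
have e1 : p <= p < p + (b - a) by lra.
have e2 : p <= p + (u - a) < p + (b - a) by lra.
by have := E e1 e2; lra.
Qed.

Lemma block_interval_stable (n : nat) (J : set R) x y (p q : R) :
  block_interval l pi n J -> p <= x < q -> p <= y < q ->
  (forall z, p < z < q -> ~ D n z) -> J x -> J y.
Proof.
case=> a [b [Da Db ab _ ->]] xpq ypq noD; rewrite /= !in_itv/= => xab.
apply/andP; split; rewrite leNgt || rewrite ltNge; apply/negP => h.
  by apply: (noD a) => //; lra.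
by apply: (noD b) => //; lra.
Qed.

(** What is read along fewer than n steps of an orbit is constant on the blocks
    of order n; this is how statements about a single orbit segment become
    statements about sets of positive measure. *)
Definition blockwise n (f : R -> R) : Prop := forall a b, adjacent n a b ->
  forall u v, a <= u < b -> a <= v < b -> f u = f v.

Definition resolved n K (f : R -> R) : Prop :=
  forall j, (j <= K)%N -> blockwise n (f \o iter j T).

Lemma resolved_birkhoff n K w (f : R -> R) :
  resolved n (K + w) f -> resolved n K (birkhoff T w f).
Proof.
move=> hf j jK a b ab u v uab vab; rewrite /comp /birkhoff; congr (_ * _).
apply: eq_bigr => i _; rewrite -!iterD.
by apply: (hf (i + j)%N _ _ _ ab) => //; have := ltn_ord i; lia.
Qed.

Lemma resolved_comp n K (g : R -> R) (f : R -> R) :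
  resolved n K f -> resolved n K (g \o f).
Proof. by move=> hf j jK a b ab u v uab vab /=; congr g; exact: (hf j jK _ _ ab). Qed.

(** An end point of J inside the image of a block would give a discontinuity
    inside that block. *)
Lemma resolved_indic n m K (J : set R) : block_interval l pi m J ->
  (K + m <= n)%N -> resolved n K \1_J.
Proof.
move=> hJ Kmn j jK a b adj u v uab vab /=; rewrite !indicE.
have [Da Db ab noD] := adj.
have jn : (j <= n)%N by lia.
suff imp u1 v1 : a <= u1 < b -> a <= v1 < b ->
    J (iter j T u1) -> J (iter j T v1).
  by congr (nat_of_bool _)%:R; apply/idP/idP; rewrite !inE; exact: imp.
move=> u1ab v1ab.
rewrite (block_translation adj jn u1ab) (block_translation adj jn v1ab).
apply: (@block_interval_stable m J _ _ (iter j T a) (iter j T a + (b - a))) => //;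
  [lra|lra|].
move=> z hz Dz.
have h : a <= a + (z - iter j T a) < b by lra.
have zE : iter j T (a + (z - iter j T a)) = z.
  by rewrite (block_translation adj jn h); ring.
have z01 : 0 < z < 1.
  have aab : a <= a < b by lra.
  have /andP[_] := iter_iet01 j (block01 adj h).
  have /andP[+ _] := iter_iet01 j (block01 adj aab).
  by rewrite zE; lra.
have [i im hi] := iet_iter_disc_elim Dz z01.
apply: (noD (a + (z - iter j T a))); first by lra.
apply: (@iet_iter_disc_intro n (i + j)); [clear -im jK Kmn; lia|exact: block01 adj h|].
by rewrite iterD zE.
Qed.

(** * Spacing of orbits *)

Section Minimal.
Hypothesis minT : iet_minimal l pi.

Lemma orbit_meets x (a b : R) : 0 <= x < 1 -> 0 <= a -> a < b -> b <= 1 ->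
  exists y k, [/\ a < y < b, 0 <= y < 1 & iter k T x = y \/ iter k T y = x].
Proof.
move=> x01 a0 ab b1; pose z := (a + b) / 2.
have z01 : I01 z by rewrite /= in_itv/= /z; lra.
have nz : nbhs z `]a, b[%classic.
  by apply: open_nbhs_nbhs; split; [exact: interval_open|rewrite /= in_itv/= /z; lra].
have [y [[y01 [k hk]] yab]] := minT x01 z01 nz.
by exists y, k; split.
Qed.

(** A periodic orbit is finite, also in the past since T is injective, so it
    misses an interval. *)
Lemma iet_aperiodic x r : 0 <= x < 1 -> (0 < r)%N -> iter r T x <> x.
Proof.
move=> x01 r0 per.
have perm_ m : iter (m * r) T x = x.
  by elim: m => // m IH; rewrite mulSn iterD IH per.
have redu k : iter k T x = iter (k %% r) T x.
  by rewrite {1}(divn_eq k r) addnC iterD perm_.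
pose s := [seq iter j T x | j <- iota 0 r].
have ins k : iter k T x \in s.
  by rewrite redu; apply: map_f; rewrite mem_iota add0n ltn_mod.
have [a [b [ain bin axb ab]]] := bracketing s x01.
have in01 z : z \in [:: 0, 1 & s] -> 0 <= z <= 1.
  rewrite !inE => /or3P[/eqP->|/eqP->|]; rewrite ?lexx ?ler01//.
  by move=> /mapP[j _ ->]; have := iter_iet01 j x01; lra.
have a01 := in01 a ain; have b01 := in01 b bin.
have [|||y [k [yab y01 hk]]] := @orbit_meets x a b x01; [lra|lra|lra|].
suff /ab : y \in s by rewrite yab.
case: hk => [<-//|hk].
suff -> : y = iter (k * r.-1) T x by [].
apply: (@iter_iet_inj k) => //; first exact: iter_iet01.
rewrite hk -iterD -mulnS prednK// perm_ //.
Qed.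

Definition long n e := forall a b, adjacent n a b -> e < b - a.

Lemma disc_separated n e p q : long n e -> D n p -> D n q -> p < q -> e < q - p.
Proof.
move=> hlong Dp Dq pq.
have [|a [b [adj pab]]] := @exists_block n p.
  by have := iet_iter_disc01 Dp; have := iet_iter_disc01 Dq; lra.
have [Da Db ab noD] := adj.
have bq : b <= q.
  by rewrite leNgt; apply/negP => qb; apply: (noD q) => //; lra.
have ap : a = p.
  apply/eqP; rewrite eq_le; apply/andP; split; first by lra.
  by rewrite leNgt; apply/negP => h; apply: (noD p) => //; lra.
by have := hlong _ _ adj; lra.
Qed.

(** A return of x to itself within distance e in r steps, with 2 r <= n,
    would translate the whole block of order r of x by at most e, less than
    its length.  The end point towards which it moves would then be the image
    of another point of the block, and both would be discontinuities of order
    n at distance at most e. *)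
Lemma return_separated n e r x : long n e -> (0 < r)%N -> (2 * r <= n)%N ->
  0 <= x < 1 -> e < `|iter r T x - x|.
Proof.
move=> hlong r0 rn x01.
have [a [b [adj xab]]] := exists_block r x01.
have [Da Db ab noD] := adj.
pose t := iter r T x - x.
have trans u : a <= u < b -> iter r T u = u + t.
  move=> uab; rewrite (block_translation adj (leqnn r) uab) /t.
  by rewrite (block_translation adj (leqnn r) xab); ring.
have t0 : t != 0.
  by rewrite subr_eq0; apply/eqP; exact: iet_aperiodic.
rewrite -/t ltNge; apply/negP => te.
have rn' : (r <= n)%N by lia.
have eab : e < b - a.
  exact: disc_separated hlong (iet_iter_disc_sub rn' Da) (iet_iter_disc_sub rn' Db) ab.
have preD p u : 0 < p < 1 -> a <= u < b -> iter r T u = p -> D r p -> D n u.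
  move=> p01 uab up Dp; have [i ir hi] := iet_iter_disc_elim Dp p01.
  apply: (@iet_iter_disc_intro n (i + r)); [clear -ir rn; lia|exact: block01 adj uab|].
  by rewrite iterD up.
have aab : a <= a < b by lra.
have a01 := block01 adj aab.
have Ta01 := iter_iet01 r a01.
have b1 := iet_iter_disc01 Db.
have [tpos|tneg|tz] := ltrgt0P t; last by rewrite tz eqxx in t0.
- move: te; rewrite gtr0_norm// => te.
  have h : a <= b - t < b by lra.
  have Tb : iter r T (b - t) = b by rewrite trans// subrK.
  have b01 : 0 < b < 1.
    by have := iter_iet01 r (block01 adj h); rewrite Tb; lra.
  have := disc_separated hlong (preD _ _ b01 h Tb Db) (iet_iter_disc_sub rn' Db).
  by lra.
- move: te; rewrite ltr0_norm// => te.
  have h : a <= a - t < b by lra.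
  have Tb : iter r T (a - t) = a by rewrite trans// subrK.
  have a01' : 0 < a < 1.
    by move: Ta01; rewrite trans//; lra.
  have := disc_separated hlong (iet_iter_disc_sub rn' Da) (preD _ _ a01' h Tb Da).
  by lra.
Qed.

Lemma orbit_separated n e x j k : long n e -> (j < k)%N -> (2 * k <= n)%N ->
  0 <= x < 1 -> e < `|iter k T x - iter j T x|.
Proof.
move=> hlong jk kn x01.
rewrite -(subnK (ltnW jk)) iterD; apply: return_separated hlong _ _ _.
- by rewrite subn_gt0.
- by clear -jk kn; lia.
- exact: iter_iet01.
Qed.

(** The first K points of the orbit of the left end point of the block of x are
    the left ends of disjoint intervals of length e, on each of which g takes
    its value at the corresponding point of the orbit of x. *)
Lemma orbit_sum_le_mean n e K x (g : R -> R) : long n e -> 0 < e -> (2 * K <= n)%N ->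
  0 <= x < 1 -> bmeas g -> (forall y, 0 <= g y) -> resolved n K g ->
  e * \sum_(j < K) g (iter j T x) <= mean g.
Proof.
move=> hlong e0 Kn x01 bg g0 rg.
have [a [b [adj xab]]] := exists_block n x01.
have eab := hlong _ _ adj.
have aab : a <= a < b by lra.
have a01 := block01 adj aab.
pose E (j : nat) : set R := `[iter j T a, iter j T a + e[%classic.
have trans j u : (j < K)%N -> a <= u < b ->
    iter j T u = iter j T a + (u - a).
  by move=> jK; apply: (block_translation adj); clear -jK Kn; lia.
have meanE j : (j < K)%N -> mean \1_(E j) = e.
  move=> jK; rewrite mean_indic_itv; first by ring.
  - by have := iter_iet01 j a01; lra.
  - by lra.
  - have h : a <= a + e < b by lra.
    by have := iter_iet01 j (block01 adj h); rewrite trans//; lra.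
have mE j : measurable (E j) by exact: measurable_itv.
have bF j : bmeas (fun y => g (iter j T x) * \1_(E j) y).
  by apply: bmeasM; [exact: bmeas_cst|exact: bmeas_indic].
have -> : e * \sum_(j < K) g (iter j T x) =
    mean (fun y => \sum_(j < K) g (iter j T x) * \1_(E j) y).
  rewrite (mean_sum (F := fun j y => g (iter j T x) * \1_(E j) y))//.
  rewrite mulr_sumr; apply: eq_bigr => j _.
  by rewrite meanZ ?meanE// 1?mulrC//; exact: bmeas_indic.
apply: mean_le => //.
  exact: (bmeas_sum (F := fun j y => g (iter j T x) * \1_(E j) y)).
move=> y y01.
have [[j [jK yj]]|none] := pselect (exists j, (j < K)%N /\ E j y); last first.
  rewrite big1// => j _; rewrite indicE memNset ?mulr0// => yj.
  by apply: none; exists j.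
have disj k : (k < K)%N -> k != j -> ~ E k y.
  move=> kK kj yk; move: yj yk; rewrite /E /= !in_itv/= => yj yk.
  have [lt_kj|lt_jk|eq_kj] := ltngtP k j; last by rewrite eq_kj eqxx in kj.
    have := orbit_separated hlong lt_kj (n := n) (x := a) _ a01.
    rewrite ltr_normr => /(_ _)/orP[]; first by clear -jK Kn; lia.
      by lra.
    by lra.
  have := orbit_separated hlong lt_jk (n := n) (x := a) _ a01.
  rewrite ltr_normr => /(_ _)/orP[]; first by clear -kK Kn; lia.
    by lra.
  by lra.
rewrite (bigD1 (Ordinal jK))//= [X in _ + X]big1 ?addr0; last first.
  move=> k kj; rewrite indicE memNset ?mulr0//; apply: disj => //.
rewrite indicE mem_set// mulr1.
move: yj; rewrite /E /= in_itv/= => yj.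
have h : a <= a + (y - iter j T a) < b by lra.
have yE : y = iter j T (a + (y - iter j T a)) by rewrite trans//; ring.
rewrite le_eqVlt; apply/orP; left; apply/eqP; rewrite yE.
exact: (rg j (ltnW jK) _ _ adj _ _ xab h).
Qed.

Lemma resolved_le n K K' (f : R -> R) : (K' <= K)%N ->
  resolved n K f -> resolved n K' f.
Proof. by move=> KK h j jK; apply: h; exact: leq_trans KK. Qed.

Lemma resolved_bvar n K w (f : R -> R) : (0 < w)%N ->
  resolved n (K + w) f -> resolved n K (bvar T w f).
Proof.
move=> w0 hf j jK a b adj u v uab vab /=; rewrite !bvarE//.
have := resolved_birkhoff hf jK adj uab vab => /= ->.
have := resolved_birkhoff (resolved_comp (fun r => r ^+ 2) hf) jK adj uab vab.
by rewrite /comp /= => ->.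
Qed.

Lemma bands_disjoint (lo beta v : R) (p : nat) : 0 < beta ->
  \sum_(i < p) \1_(`]lo + i%:R * beta, lo + i.+1%:R * beta[ : set R) v <= 1 :> R.
Proof.
move=> beta0.
pose P (i : 'I_p) := (lo + i%:R * beta < v < lo + i.+1%:R * beta).
have indE (i : 'I_p) :
    \1_(`]lo + i%:R * beta, lo + i.+1%:R * beta[ : set R) v = (P i)%:R :> R.
  by rewrite indicE mem_setE in_itv.
have [[i Pi]|none] := pselect (exists i, P i); last first.
  rewrite big1 ?ler01// => i _; rewrite indE; case: (boolP (P i)) => // Pi.
  by case: none; exists i.
rewrite (bigD1 i)//= [X in _ + X]big1 ?addr0; first by rewrite indE Pi.
move=> k ki; rewrite indE; case: (boolP (P k)) => // Pk; exfalso.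
case/negP: ki; apply/eqP/val_inj/eqP; move: Pi Pk; rewrite /P /=.
case: (ltngtP k i) => // ki.
  have : k.+1%:R <= i%:R :> R by rewrite ler_nat.
  by nra.
have : i.+1%:R <= k%:R :> R by rewrite ler_nat.
by nra.
Qed.

(** * Variance lost by averaging *)

Section VarianceDrop.
Variables (n w p : nat) (e M : R) (F : R -> R).
Hypothesis hlong : long n e.
Hypothesis e0 : 0 < e.
Hypothesis w4 : (4 <= w)%N.
Hypothesis wn : (8 * w <= n)%N.
Hypothesis p0 : (0 < p)%N.
Hypothesis M0 : 0 < M.
Hypothesis bF : bmeas F.
Hypothesis rF : resolved n (4 * w) F.
Hypothesis oscF : forall x y, 0 <= x < 1 -> 0 <= y < 1 -> F x - F y <= M.

Local Notation G := (birkhoff T w F).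
Local Notation V := (bvar T w F).
(** Width of the p bands that fill a range of size M / 2. *)
Let beta : R := M / (2 * p%:R).

Let w0 : (0 < w)%N. Proof. by apply: leq_trans w4. Qed.

Let resolved_G : resolved n (3 * w) G.
Proof. by apply: resolved_birkhoff; rewrite -mulSnr. Qed.

Let beta0 : 0 < beta.
Proof. by rewrite /beta divr_gt0// mulr_gt0// ltr0n. Qed.

Let bG : bmeas G.
Proof. exact: (bmeas_birkhoff measurable_iet). Qed.

(** If every band takes more than half a window to cross, each of them contains
    the values of G along a long orbit segment, hence on a set of measure
    bounded below; these sets are disjoint, so the bands are few. *)
Lemma slow_bands_few lo :
  (forall i, (i < p)%N -> exists2 z, 0 <= z < 1 &
    forall j, (j < (w.-1)./2)%N ->
      lo + i%:R * beta < G (iter j T z) < lo + i.+1%:R * beta) ->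
  p%:R * (e * w%:R) <= 4.
Proof.
(* More than w / 2 steps leave at least (w - 1) / 2 >= w / 4 inner points. *)
move=> slow; set K := (w.-1)./2.
pose B (i : nat) : set R := `]lo + i%:R * beta, lo + i.+1%:R * beta[%classic.
pose g (i : nat) : R -> R := \1_(B i) \o G.
have bg i : bmeas (g i).
  apply: bmeas_comp; first by case: bG.
  by apply: bmeas_indic; exact: measurable_itv.
have Kn : (2 * K <= n)%N by rewrite /K; clear -wn; lia.
have meang i : (i < p)%N -> e * K%:R <= mean (g i).
  move=> ip; have [z z01 hz] := slow i ip.
  have -> : K%:R = \sum_(j < K) g i (iter j T z).
    rewrite -[LHS](_ : \sum_(j < K) 1 = _); last by rewrite sumr_const card_ord.
    apply: eq_bigr => j _; rewrite /g /= indicE mem_set//.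
    by rewrite /B /= in_itv/=; exact: hz.
  apply: orbit_sum_le_mean hlong e0 Kn z01 (bg i) _ _.
    by move=> y; rewrite /g /= indicE ler0n.
  apply: resolved_comp; apply: resolved_le resolved_G.
  by rewrite /K; clear; lia.
have tot : \sum_(i < p) mean (g i) <= 1.
  rewrite -mean_sum// -[leRHS]mean_cst; apply: mean_le.
  - exact: bmeas_sum.
  - exact: bmeas_cst.
  - by move=> y _; apply: bands_disjoint.
have : p%:R * (e * K%:R) <= 1.
  apply: le_trans tot; rewrite -[p in p%:R]card_ord mulr_natl -sumr_const.
  by apply: ler_sum => i _; exact: meang.
have wK : w%:R <= 4 * K%:R :> R.
  by rewrite -natrM ler_nat /K; clear -w4; lia.
have pe : 0 <= p%:R * e by rewrite mulr_ge0// ltW.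
by nra.
Qed.

(** The means at y and T^t y differ by beta, and by beta / 2 at least when both
    points move by j <= w / (8 p) steps, since each mean then changes by at most
    beta / 4; overlapping windows turn this into variance at one of the two
    points for each such j. *)
Lemma fast_band_variance y t : 0 <= y < 1 -> (2 * t <= w)%N ->
  beta <= `|G (iter t T y) - G y| ->
  (e * w%:R) * M ^+ 2 / (1024 * p%:R ^+ 3) <= mean V.
Proof.
move=> y01 tw hfast; pose K := (w %/ (8 * p)).+1.
have pR : 0 < p%:R :> R by rewrite ltr0n.
have wR : 0 < w%:R :> R by rewrite ltr0n.
have lipG z j : 0 <= z < 1 -> `|G (iter j T z) - G z| <= j%:R * (M / w%:R).
  move=> z01; apply: birkhoff_lipschitz => i k; rewrite ler_norml; apply/andP.
  have iz := iter_iet01 i z01; have kz := iter_iet01 k z01.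
  by split; [have := oscF kz iz; lra|exact: oscF].
have pair j : (j < K)%N ->
    beta ^+ 2 / 16 <= V (iter j T y) + V (iter j T (iter t T y)).
  move=> jK.
  have := @overlap_bvar R R T w t F (iter j T y) w0 tw.
  rewrite -iterD addnC iterD.
  have l1 := lipG y j y01; have l2 := lipG _ j (iter_iet01 t y01).
  have jw : j%:R * (M / w%:R) <= beta / 4.
    rewrite /beta; have : (j * (8 * p) <= w)%N.
      by rewrite -leq_divRL ?muln_gt0//.
    rewrite -(ler_nat R) !natrM => jw.
    rewrite mulrA ler_pdivrMr// (_ : _ / 4 * _ = M * w%:R / (8 * p%:R)).
      by rewrite ler_pdivlMr ?mulr_gt0// (mulrC _ M) -mulrA ler_pM2l.
    by field; rewrite gt_eqF.
  move: hfast l1 l2; set a1 := G _; set a2 := G _; set a3 := G _; set a4 := G _.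
  move=> h1 h2 h3.
  have dist : beta / 2 <= `|a4 - a3|.
    have := ler_distD a3 a1 a2; have := ler_distD a4 a1 a3.
    by rewrite (distrC a1 a4); lra.
  have : (beta / 2) ^+ 2 <= (a4 - a3) ^+ 2.
    rewrite -[leRHS]real_normK ?num_real//.
    by rewrite ler_pXn2r// nnegrE// divr_ge0// ltW.
  by rewrite expr_div_n; lra.
have en z : 0 <= z < 1 -> e * \sum_(j < K) V (iter j T z) <= mean V.
  move=> z01; apply: orbit_sum_le_mean hlong e0 _ z01 _ _ _.
  - have : (w %/ (8 * p) <= w %/ 8)%N by rewrite divnMA leq_div.
    by rewrite /K; clear -wn w4; lia.
  - exact: (bmeas_bvar measurable_iet).
  - by move=> ?; exact: bvar_ge0.
  - apply: resolved_bvar => //; apply: resolved_le rF.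
    have : (w %/ (8 * p) <= w)%N by exact: leq_div.
    by rewrite /K; clear -w4; lia.
have sumK : K%:R * (beta ^+ 2 / 16) <=
    \sum_(j < K) V (iter j T y) + \sum_(j < K) V (iter j T (iter t T y)).
  rewrite -big_split /= -[K in K%:R]card_ord mulr_natl -sumr_const.
  by apply: ler_sum => j _; exact: pair.
have e1 := en _ y01; have e2 := en _ (iter_iet01 t y01).
have KR : w%:R <= K%:R * (8 * p%:R) :> R.
  by rewrite -!natrM ler_nat ltnW// ltn_ceil// muln_gt0.
have KR' : w%:R / (8 * p%:R) <= K%:R :> R by rewrite ler_pdivrMr// mulr_gt0.
(* The final factor 1 / 2 comes from adding up two orbit segments that may
   overlap. *)
have -> : (e * w%:R) * M ^+ 2 / (1024 * p%:R ^+ 3) =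
    e * ((w%:R / (8 * p%:R)) * (beta ^+ 2 / 16)) / 2.
  by rewrite /beta; field; rewrite gt_eqF.
have : e * ((w%:R / (8 * p%:R)) * (beta ^+ 2 / 16)) <=
    e * (K%:R * (beta ^+ 2 / 16)).
  by rewrite ler_pM2l// ler_wpM2r// divr_ge0// sqr_ge0.
have := ler_wpM2l (ltW e0) sumK; rewrite mulrDr; lra.
Qed.

(** The hypothesis on p excludes that all the bands are slow. *)
Lemma variance_drop x y : 0 <= x < 1 -> 0 <= y < 1 -> M / 2 < G x - G y ->
  4 < p%:R * (e * w%:R) ->
  (e * w%:R) * M ^+ 2 / (1024 * p%:R ^+ 3) <=
  mean (fun x => F x ^+ 2) - mean (fun x => G x ^+ 2).
Proof.
move=> x01 y01 Gxy pew.
rewrite -(mean_bvar measurable_iet mean_iet)//.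
have pR : 0 < p%:R :> R by rewrite ltr0n.
have [a [b [adj yab]]] := exists_block n y01.
have [Da Db ab _] := adj.
have [||z [k [zab z01 hk]]] := @orbit_meets x a b x01 _ ab.
- by have := iet_iter_disc01 Da; lra.
- by have := iet_iter_disc01 Db; lra.
have zab' : a <= z < b by lra.
have Gz : G z = G y := resolved_G (leq0n _) adj zab' yab.
pose lo := G y.
have bandx (i : nat) : (i < p)%N -> lo + i.+1%:R * beta <= G x.
  move=> ip; have : i.+1%:R <= p%:R :> R by rewrite ler_nat.
  move=> /(ler_wpM2r (ltW beta0)).
  have : p%:R * beta = M / 2 by rewrite /beta; field; rewrite gt_eqF.
  by rewrite /lo; lra.
have bandy (i : nat) : G y <= lo + i%:R * beta.
  by rewrite /lo lerDl mulr_ge0// ltW.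
have [z0 [z001 cross]] : exists z0, 0 <= z0 < 1 /\ forall i : nat, (i < p)%N ->
    (G z0 <= lo + i%:R * beta /\ lo + i.+1%:R * beta <= G (iter k T z0)) \/
    (lo + i.+1%:R * beta <= G z0 /\ G (iter k T z0) <= lo + i%:R * beta).
  case: hk => hk; [exists x|exists z]; split=> // i ip.
    by right; rewrite hk Gz; split; [exact: bandx|exact: bandy].
  by left; rewrite hk Gz; split; [exact: bandy|exact: bandx].
have [[u [t [u01 tw ut]]]|nofast] := pselect (exists u t,
    [/\ 0 <= u < 1, (2 * t <= w)%N & beta <= `|G (iter t T u) - G u|]).
  exact: fast_band_variance ut.
exfalso; suff : p%:R * (e * w%:R) <= 4 by lra.
apply: (@slow_bands_few lo) => i ip.
have lohi : lo + i%:R * beta < lo + i.+1%:R * beta.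
  by rewrite ltrD2l ltr_pM2r// ltr_nat.
have [j0 [j1 [/andP[j01 _] hj h]]] :=
  band_crossing (s := fun j => G (iter j T z0)) lohi (cross i ip).
exists (iter j0.+1 T z0); first exact: iter_iet01.
move=> j jw; rewrite -iterD; apply: h.
suff : (w < 2 * (j1 - j0))%N by clear -jw j01; lia.
rewrite ltnNge; apply/negP => fast; apply: nofast.
exists (iter j0 T z0), (j1 - j0)%N; split=> //; first exact: iter_iet01.
rewrite -iterD subnK; last exact: ltnW.
apply: le_trans hj; rewrite -natr1; lra.
Qed.

End VarianceDrop.


(** * Iterated averages *)

(** The windows are one eighth of the scales, so that the total time seen by
    smooth v f r, and one more window, stay well below v r. *)
Fixpoint smooth (v : nat -> nat) (f : R -> R) (r : nat) : R -> R :=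
  if r is r'.+1 then birkhoff T (v r' %/ 8) (smooth v f r') else f.

Lemma bmeas_smooth v f r : bmeas f -> bmeas (smooth v f r).
Proof. by move=> bf; elim: r => //= r; exact: (bmeas_birkhoff measurable_iet). Qed.

Lemma resolved_smooth (v : nat -> nat) (f : R -> R) n K r :
  resolved n (K + \sum_(i < r) v i %/ 8) f -> resolved n K (smooth v f r).
Proof.
elim: r K => [|r IH] K; first by rewrite big_ord0 addn0.
rewrite big_ord_recr /= => hf; apply: resolved_birkhoff; apply: IH.
by rewrite -addnA (addnC (v r %/ 8)%N).
Qed.

Definition osc_le (f : R -> R) M :=
  forall x y, 0 <= x < 1 -> 0 <= y < 1 -> f x - f y <= M.

Lemma osc_le_birkhoff w f M : (0 < w)%N -> osc_le f M ->
  osc_le (birkhoff T w f) M.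
Proof.
move=> w0 hf x y x01 y01; rewrite lerBlDl -lerBlDr.
apply: birkhoff_ge => // j _; rewrite lerBlDr -lerBlDl lerBlDr.
apply: birkhoff_le => // i _; rewrite -lerBlDr.
by apply: hf; exact: iter_iet01.
Qed.

Lemma length_block m (J : set R) : block_interval l pi m J ->
  mean \1_J = length_of J /\ 0 < length_of J.
Proof.
case=> a [b [Da Db ab _ ->]].
have a01 := iet_iter_disc01 Da; have b01 := iet_iter_disc01 Db.
rewrite mean_indic_itv//; [|lra|lra].
rewrite /length_of lebesgue_measure_itv/= lte_fin ab -EFinB /=; split=> //; lra.
Qed.

Lemma bmeas_block m (J : set R) : block_interval l pi m J ->
  bmeas (\1_J : R -> R).
Proof. by case=> a [b [_ _ _ _ ->]]; apply: bmeas_indic; exact: measurable_itv. Qed.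

Lemma visits_le m n e s (J : set R) x : block_interval l pi m J ->
  long n e -> 0 < e -> (2 * s <= n)%N -> (s + m <= n)%N -> 0 <= x < 1 ->
  e * \sum_(j < s) \1_J (iter j T x) <= length_of J.
Proof.
move=> hJ hlong e0 sn smn x01; have [<- _] := length_block hJ.
apply: (orbit_sum_le_mean hlong) => //.
- exact: bmeas_block hJ.
exact: resolved_indic hJ smn.
Qed.

Lemma mean_sqr_shift f A : bmeas f ->
  mean (fun x => (f x - A) ^+ 2) =
  mean (fun x => f x ^+ 2) - 2 * A * mean f + A ^+ 2.
Proof.
move=> bf; rewrite (_ : (fun x => _) =
    (fun x => f x ^+ 2 - 2 * A * f x + A ^+ 2)); last first.
  by apply/funext => x; ring.
have b1 : bmeas (fun x => 2 * A * f x) by apply: bmeasM => //; exact: bmeas_cst.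
rewrite meanD; last exact: bmeas_cst.
  by rewrite meanB ?mean_cst ?meanZ//; exact: bmeas_sqr.
by apply: bmeasB => //; exact: bmeas_sqr.
Qed.

Section Scales.
Variable v : nat -> nat.
Hypothesis v2 : forall r, (2 * v r <= v r.+1)%N.

Lemma sum_windows r : (\sum_(i < r) v i %/ 8 <= v r %/ 8)%N.
Proof.
elim: r => [|r IH]; first by rewrite big_ord0.
rewrite big_ord_recr /=; apply: leq_trans (leq_add IH (leqnn _)) _.
by have := v2 r; clear; lia.
Qed.

Variables (m : nat) (J : set R) (c : R).
Hypothesis m0 : (0 < m)%N.
Hypothesis vm : (32 * m <= v 0)%N.
Hypothesis hJ : block_interval l pi m J.
Hypothesis c0 : 0 < c.
Hypothesis hlong : forall r, long (v r) (c / (v r)%:R).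

Local Notation F := (smooth v \1_J).

Let vge r : (32 * m <= v r)%N.
Proof.
by elim: r => // r IH; apply: leq_trans IH _; have := v2 r; clear; lia.
Qed.

Let v0 r : (0 < v r)%N. Proof. by have := vge r; clear -m0; lia. Qed.

Let w0 r : (0 < v r %/ 8)%N. Proof. by have := vge r; clear -m0; lia. Qed.

Let e0 r : 0 < c / (v r)%:R. Proof. by rewrite divr_gt0// ltr0n. Qed.

(** Intervals of length c / v r around the points of a window have total length
   at least c / 16: rounding v r / 8 down loses at most a factor 2. *)
Let window_mass r : c / 16 <= c / (v r)%:R * (v r %/ 8)%:R.
Proof.
rewrite -mulrA ler_pM2l// ler_pdivlMl ?ltr0n// ler_pdivrMr// -natrM ler_nat.
by have := vge r; clear -m0; lia.
Qed.

(** Averages commute, so averaging the values of the smoothed function over N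
    steps is smoothing its averages over N steps: the result lies between the
    extreme values of the latter along the smoothing windows. *)
Lemma birkhoff_smooth_itv N f r x lo hi :
  (forall s, (s <= \sum_(i < r) v i %/ 8)%N ->
    lo <= birkhoff T N f (iter s T x) <= hi) ->
  lo <= birkhoff T N (smooth v f r) x <= hi.
Proof.
elim: r x => [|r IH] x h; first by apply: (h 0%N).
have h' j : (j < v r %/ 8)%N ->
    lo <= birkhoff T N (smooth v f r) (iter j T x) <= hi.
  move=> jw; apply: IH => s sle; rewrite -iterD; apply: h.
  by rewrite big_ord_recr /=; exact: leq_add sle (ltnW jw).
rewrite /= birkhoffC; apply/andP; split.
  by apply: birkhoff_ge => // j /h' /andP[].
by apply: birkhoff_le => // j /h' /andP[].
Qed.

Lemma bmeasF r : bmeas (F r).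
Proof. by apply: bmeas_smooth; exact: bmeas_block hJ. Qed.

Lemma meanF r : mean (F r) = mean \1_J.
Proof.
elim: r => // r <-; apply: (mean_birkhoff measurable_iet mean_iet) => //.
exact: bmeasF.
Qed.

Lemma resolvedF r : resolved (v r) (v r %/ 2) (F r).
Proof.
apply: resolved_smooth; apply: resolved_indic hJ _.
have := sum_windows r; have := vge r; move: (\sum_(i < r) _)%N => S.
by clear; lia.
Qed.

Lemma osc_leF r s M : osc_le (F r) M -> osc_le (F (s + r)) M.
Proof. by move=> h; elim: s => // s IH; exact: osc_le_birkhoff. Qed.

(** As long as the oscillation stays above M / 2, each average costs a fixed
    fraction of M ^ 2 in variance, of which there is at most M ^ 2.  The bound
    on p is the condition 4 < p * (c / 16) under which some band is fast; the
    bound on q says that q drops exceed M ^ 2. *)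
Lemma osc_halves p q r (M : R) : 64 / c < p%:R -> 1024 * p%:R ^+ 3 * (16 / c) < q%:R ->
  0 < M -> osc_le (F r) M -> osc_le (F (q + r)) (M / 2).
Proof.
move=> hp hq M0 osc x y x01 y01; rewrite leNgt; apply/negP => hxy.
have pR : 0 < p%:R :> R by apply: lt_trans hp; rewrite divr_gt0.
have pN : (0 < p)%N by rewrite -(ltr0n R).
have big s : (s <= q)%N -> exists u z : R,
    [/\ 0 <= u < 1, 0 <= z < 1 & M / 2 < F (s + r) u - F (s + r) z].
  move=> sq; apply: contrapT => none.
  have h : osc_le (F (s + r)) (M / 2).
    move=> u z u01 z01; rewrite leNgt; apply/negP => uz.
    by apply: none; exists u, z.
  have := osc_leF (q - s) h; rewrite addnA subnK// => /(_ x y x01 y01).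
  by rewrite leNgt hxy.
have P3 : 0 < 1024 * p%:R ^+ 3 :> R.
  by apply: mulr_gt0; [rewrite ltr0n|exact: exprn_gt0].
pose Q s := mean (fun x => F (s + r) x ^+ 2).
pose D0 := (c / 16) * M ^+ 2 / (1024 * p%:R ^+ 3).
have drop s : (s < q)%N -> D0 <= Q s - Q s.+1.
  move=> sq; have [u [z [u01 z01 uz]]] := big s.+1 sq.
  have wm := window_mass (s + r).
  apply: le_trans (_ : _ <= (c / (v (s + r))%:R * (v (s + r) %/ 8)%:R) * M ^+ 2 /
     (1024 * p%:R ^+ 3)) _.
    apply: ler_wpM2r; first by rewrite invr_ge0; exact: ltW P3.
    by apply: ler_wpM2r; [exact: sqr_ge0|exact: wm].
  have FS : F (s.+1 + r) = birkhoff T (v (s + r) %/ 8) (F (s + r)) by rewrite addSn.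
  rewrite /Q FS; rewrite FS in uz.
  apply: (variance_drop (@hlong (s + r)%N) (e0 (s + r)) _ _ pN M0 (bmeasF _) _ _
    u01 z01 uz).
  - by have := vge (s + r); clear -m0; lia.
  - by clear; lia.
  - apply: (resolved_le (K := (v (s + r) %/ 2)%N)); first by clear; lia.
    exact: resolvedF.
  - exact: osc_leF.
  - move: hp; rewrite ltr_pdivrMr// => hp.
    by have := ler_wpM2l (ltW pR) wm; lra.
have tele s : (s <= q)%N -> s%:R * D0 <= Q 0%N - Q s.
  elim: s => [|s IH] sq; first by rewrite mul0r subrr.
  by have := drop s sq; have := IH (ltnW sq); rewrite -natr1 mulrDl mul1r; lra.
have := tele q (leqnn q); apply/negP; rewrite -ltNge.
have z01 : 0 <= (0 : R) < 1 by rewrite lexx ltr01.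
(* Second moments may be taken about the constant A, as F r and F (q + r) have
   the same mean. *)
pose A := F r 0.
have Q0 : mean (fun x => (F r x - A) ^+ 2) <= M ^+ 2.
  rewrite -[leRHS]mean_cst; apply: mean_le.
  - by apply: bmeas_sqr; apply: bmeasB; [exact: bmeasF|exact: bmeas_cst].
  - exact: bmeas_cst.
  - move=> u u01; have := osc _ _ u01 z01; have := osc _ _ z01 u01.
    by rewrite -/A; nra.
have Qq : 0 <= mean (fun x => (F (q + r) x - A) ^+ 2).
  rewrite -[leLHS]mean_cst; apply: mean_le.
  - exact: bmeas_cst.
  - by apply: bmeas_sqr; apply: bmeasB; [exact: bmeasF|exact: bmeas_cst].
  - by move=> u _; exact: sqr_ge0.
move: Q0 Qq; rewrite !mean_sqr_shift ?meanF; try exact: bmeasF.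
rewrite -/(Q 0%N) -/(Q q) => Q0 Qq.
have : M ^+ 2 < q%:R * D0; last by lra.
have hq' : 1024 * p%:R ^+ 3 < q%:R * (c / 16).
  by move: hq; rewrite -(invf_div c) ltr_pdivrMr// divr_gt0.
have : M ^+ 2 * (1024 * p%:R ^+ 3) < M ^+ 2 * (q%:R * (c / 16)).
  by rewrite ltr_pM2l// exprn_gt0.
have -> : q%:R * D0 = M ^+ 2 * (q%:R * (c / 16)) / (1024 * p%:R ^+ 3).
  by rewrite /D0; ring.
by rewrite (ltr_pdivlMr _ _ P3).
Qed.

Lemma visits_window r s x : (s <= v r %/ 8)%N -> 0 <= x < 1 ->
  0 <= (\sum_(j < s) \1_J (iter j T x) : R) <= length_of J * (v r)%:R / c.
Proof.
move=> sr x01; apply/andP; split; first by apply: sumr_ge0 => j _.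
have := visits_le (s := s) hJ (@hlong r) (e0 r) _ _ x01.
rewrite mulrAC ler_pdivrMr ?ltr0n// ler_pdivlMr// mulrC; apply.
  by clear -sr; lia.
by have := vge r; clear -sr; lia.
Qed.

Lemma osc_start : osc_le (F 1) (16 * length_of J / c).
Proof.
have bnd x : 0 <= x < 1 -> 0 <= F 1 x <= 16 * length_of J / c.
  move=> x01; have [_ J0] := length_block hJ.
  have /andP[h0 h1] := visits_window (leqnn (v 0%N %/ 8)) x01.
  rewrite /= /birkhoff mulr_ge0 ?invr_ge0//= mulrC.
  rewrite ler_pdivrMr ?ltr0n//; apply: le_trans h1 _.
  rewrite [leRHS]mulrAC ler_pM2r ?invr_gt0//.
  have : (v 0%N)%:R <= 16 * (v 0%N %/ 8)%:R :> R.
    by rewrite -natrM ler_nat; have := vge 0; clear -m0; lia.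
  by move=> /(ler_wpM2l (ltW J0)); lra.
by move=> x y /bnd + /bnd; lra.
Qed.

(** Comparison of the averages of the indicator of J over N steps with those of
    its smoothing, whose oscillation has been halved k times: the constant 18
    is 16 from this oscillation and 1 from the smoothing error at each of the
    two points. *)
Lemma discrepancy p q k N x x' :
  64 / c < p%:R -> 1024 * p%:R ^+ 3 * (16 / c) < q%:R ->
  (v (q * k + 1) * 2 ^ k <= N)%N -> 0 <= x < 1 -> 0 <= x' < 1 ->
  `|birkhoff T N \1_J x - birkhoff T N \1_J x'| <=
    18 * length_of J / c / 2 ^+ k.
Proof.
move=> hp hq vN x01 x'01; have [_ J0] := length_block hJ.
set r := (q * k + 1)%N in vN *.
have Npos : (0 < N)%N.
  by apply: leq_trans vN; rewrite muln_gt0 v0 expn_gt0.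
have NR : 0 < N%:R :> R by rewrite ltr0n.
have k2 : 0 < 2 ^+ k :> R by rewrite exprn_gt0.
have oscr : osc_le (F r) (16 * length_of J / c / 2 ^+ k).
  rewrite /r; elim: (k) => [|k' IH].
    by rewrite muln0 expr0 divr1; exact: osc_start.
  rewrite mulnS -addnA exprS invfM mulrCA mulrC; apply: (osc_halves hp hq) => //.
  by rewrite !divr_gt0// ?mulr_gt0// exprn_gt0.
pose B := length_of J / c / 2 ^+ k.
have err z : 0 <= z < 1 ->
    `|birkhoff T N (F r) z - birkhoff T N \1_J z| <= B.
  move=> z01; rewrite ler_distl; apply: birkhoff_smooth_itv => s sr.
  have {}sr := leq_trans sr (sum_windows r).
  have := visits_window sr (iter_iet01 N z01).
  have := visits_window sr z01.
  rewrite -ler_distl /birkhoff sum_orbit_shift -mulrBr addrC addKr.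
  set a := \sum_(j < s) _; set b := \sum_(j < s) _ => ha hb.
  rewrite normrM ger0_norm ?invr_ge0// mulrC ler_pdivrMr//.
  have le1 : length_of J * (v r)%:R / c <= B * N%:R.
    have : ((v r)%:R * 2 ^+ k : R) <= N%:R by rewrite -natrX -natrM ler_nat.
    rewrite -ler_pdivlMr// => vr.
    rewrite /B -mulrA mulrAC [leRHS](_ : _ = length_of J / c * (N%:R / 2 ^+ k)).
      by rewrite mulrA mulrAC ler_wpM2l// divr_ge0// ltW.
    by ring.
  by rewrite ler_norml; apply/andP; split; lra.
have h := osc_le_birkhoff Npos oscr.
have hx := h _ _ x01 x'01; have hx' := h _ _ x'01 x01.
have := err _ x01; have := err _ x'01; rewrite !ler_norml.
have -> : 18 * length_of J / c / 2 ^+ k = 16 * length_of J / c / 2 ^+ k + 2 * B.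
  by rewrite /B; field; rewrite !gt_eqF.
by lra.
Qed.

End Scales.

End Minimal.
End IntervalExchangeMap.

(** * Exponential decay *)

Lemma min_block_long (R : realType) (d : nat) (l : 'I_d -> R) (pi : 'S_d)
    (n : nat) (e : R) : e < min_block l pi n -> long l pi n e.
Proof.
move=> he a b [Da Db ab noD]; apply: lt_le_trans he _.
have -> : b - a = length_of (`[a, b[%classic : set R).
  by rewrite /length_of lebesgue_measure_itv/= lte_fin ab -EFinB.
apply: ge_inf; last first.
  by exists `[a, b[%classic => //; exists a, b.
exists 0 => _ [J _ <-]; rewrite /length_of fine_ge0//.
Qed.

Lemma half_powers_expR (R : realType) (q L : nat) : (0 < q)%N ->
  (2 ^+ (L %/ (2 * q)))^-1 <= 2 * expR (- (ln 2 / (2 * q)%:R) * L%:R) :> R.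
Proof.
move=> q0; set k := (L %/ _)%N.
have q2 : 0 < (2 * q)%:R :> R by rewrite ltr0n muln_gt0.
have ln2 : 0 < ln 2 :> R by rewrite ln_gt0// ltr1n.
have Lk : (L%:R : R) <= k.+1%:R * (2 * q)%:R.
  by rewrite -natrM ler_nat ltnW// ltn_ceil// muln_gt0.
have E : expR (- (ln 2 *+ k.+1)) = (2 ^+ k.+1)^-1 :> R.
  by rewrite expRN -[_ *+ _]mulr_natl expRM_natl lnK// posrE.
have -> : (2 ^+ k)^-1 = 2 * expR (- (ln 2 *+ k.+1)) :> R.
  by rewrite E exprS invfM mulVKf// pnatr_eq0.
rewrite ler_pM2l// ler_expR mulNr lerN2 -[ln 2 *+ _]mulr_natr.
by rewrite -mulrA ler_pM2l// mulrC ler_pdivrMr.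
Qed.

Theorem theorem1p3 (R : realType) (c : R) (hc : 0 < c) :
  exists (C1 C2 : R) (q : nat),
    [/\ 0 < C1, 0 < C2, (0 < q)%N &
      forall (d : nat) (l : 'I_d -> R) (pi : 'S_d),
        (forall k, 0 <= l k) ->
        \sum_(k < d) l k = 1 ->
        iet_minimal l pi ->
        forall n : nat -> nat,
          (forall j, (1 <= j)%N -> (0 < n j)%N) ->
          (forall j, (1 <= j)%N -> 2 < (n j.+1)%:R / (n j)%:R :> R) ->
          (forall j, (1 <= j)%N -> c / (n j)%:R < min_block l pi (n j)) ->
          forall (i : nat) (J : set R),
            (1 <= i)%N ->
            block_interval l pi (n i) J ->
            forall (x x' : R) (L : nat),
              0 <= x < 1 ->
              0 <= x' < 1 ->
              (n (i + q + L)%N)%:R^-1 *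
                `| \sum_(1 <= j < (n (i + q + L)%N).+1)
                     (\1_J (iter j (iet l pi) x) -
                      \1_J (iter j (iet l pi) x')) |
              < C1 * expR (- C2 * L%:R) * length_of J].
Proof.
pose p := Num.bound (64 / c).
pose q := Num.bound (1024 * p%:R ^+ 3 * (16 / c)).
have hp : 64 / c < p%:R by apply: archi_boundP; rewrite divr_ge0// ltW.
have q_ge0 : 0 <= 1024 * p%:R ^+ 3 * (16 / c).
  apply: mulr_ge0; last by rewrite divr_ge0// ltW.
  by apply: mulr_ge0; [exact: ler0n|apply: exprn_ge0; exact: ler0n].
have hq : 1024 * p%:R ^+ 3 * (16 / c) < q%:R by exact: archi_boundP.
have q0 : (0 < q)%N.
  by rewrite -(ltr0n R); exact: le_lt_trans q_ge0 hq.
(* Scales start at n (i + 5) >= 32 n i and one more is used by the first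
   average, whence the shift 6.  Rounding L / (2 q) down costs a factor 2, and
   40 is any number above 2 * 18. *)
exists (40 / c), (ln 2 / (2 * q)%:R), 6%N; split=> //.
- by rewrite divr_gt0.
- by rewrite divr_gt0 ?ln_gt0 ?ltr1n ?ltr0n ?muln_gt0.
move=> d l pi l0 l1 minT n n0 n2 nlong i J i1 hJ x x' L x01 x'01.
have n2' j : (1 <= j)%N -> (2 * n j <= n j.+1)%N.
  move=> j1; have := n2 j j1; rewrite ltr_pdivlMr ?ltr0n ?n0//.
  by rewrite -natrM ltr_nat => /ltnW.
have grow j k : (1 <= j)%N -> (n j * 2 ^ k <= n (k + j))%N.
  move=> j1; elim: k => [|k IH]; first by rewrite muln1.
  rewrite expnS mulnCA addSn; apply: leq_trans (n2' _ _); last first.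
    by rewrite addn_gt0 j1 orbT.
  by rewrite leq_mul2l IH orbT.
pose v r := n (r + (i + 5))%N.
(* At most half of the L remaining scales are used to halve the oscillation;
   the others, at least k of them, make N long compared with the windows. *)
pose k := (L %/ (2 * q))%N.
have qk : (2 * q * k <= L)%N by rewrite mulnC leq_divM.
set N := n (i + 6 + L)%N.
have v2 r : (2 * v r <= v r.+1)%N.
  by apply: n2'; rewrite addnA addn_gt0 orbT.
have vm : (32 * n i <= v 0%N)%N.
  by have := grow i 5%N i1; rewrite /v add0n addnC mulnC.
have vlong r : long l pi (v r) (c / (v r)%:R).
  by apply: min_block_long; apply: nlong; rewrite addnA addn_gt0 orbT.
have vN : (v (q * k + 1) * 2 ^ k <= N)%N.
  apply: (@leq_trans (v (q * k + 1)%N * 2 ^ (L - q * k))%N).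
    rewrite leq_mul2l leq_exp2l// ; apply/orP; right.
    have : (k <= q * k)%N by rewrite leq_pmull.
    by move: qk; rewrite -mulnA; clear; lia.
  apply: leq_trans (grow _ _ _) _; first by rewrite /= !addnA addn_gt0 orbT.
  rewrite /N (_ : _ + _ = i + 6 + L)%N//.
  by move: qk; rewrite -mulnA; clear; lia.
have [_ J0] := length_block hJ.
have := discrepancy l0 l1 minT v2 (n0 i i1) vm hJ hc vlong hp hq vN
  (iet01 pi l0 l1 x01) (iet01 pi l0 l1 x'01).
rewrite /birkhoff -mulrBr -sumrB normrM ger0_norm ?invr_ge0//.
rewrite big_add1 /= big_mkord.
under eq_bigr do rewrite -!iterSr.
move=> h; apply: le_lt_trans h _.
have := half_powers_expR R L q0; rewrite -/k.
set E := expR _; set P := _^-1 => PE.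
have E0 : 0 < E by exact: expR_gt0.
have JcP : 0 < length_of J / c by rewrite divr_gt0.
have -> : 18 * length_of J / c * P = 18 * (length_of J / c * P) by ring.
have -> : 40 / c * E * length_of J = 40 * (length_of J / c * E) by ring.
have := ler_wpM2l (ltW JcP) PE.
have : 0 < length_of J / c * E by rewrite mulr_gt0.
by move=> a b; lra.
Qed.
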